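(* Consider the adaptive control setting and the passivity-based parameter update law described in the context, with optimiser state $x(t)$, variable $v(t)$, parameter error $\tilde\theta(t)=\theta(t)-\theta_c=v(t)/\gamma(t)$ and tracking error $e(t)$ defined for $t\ge t_0$. Let $$V_T(t)=V(t)+U(v(t),t)+V_e(t),\qquad V=\tfrac12x^TPx,\qquad V_e=\tfrac12e^TP_ee,$$ and let $E_{AC}=V(t_0)+U(v(t_0),t_0)+V_e(t_0)$. Then for all $t\ge t_0$: (i) $$\dot V_T=-\tfrac12x^TQx-\tfrac12e^TQ_ee-\dot\gamma\,D_f(\theta_c,\theta)-\tilde\theta^T\Omega^2\tilde\theta\le 0;$$ (ii) $$E_{AC}\ge V(t)+U(v(t),t)+V_e(t)\ge U(v(t),t)=\gamma(t)\left[f(\theta(t))-f(\theta_c)\right],$$ and hence $$f(\theta(t))-f(\theta_c)\le\frac{E_{AC}}{\gamma(t)}.$$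
   Context: Tracking error dynamics: $\dot e(t)=A_me(t)+B_p\Phi(x_p(t))\tilde\theta(t)$, where $A_m$ is a constant Hurwitz matrix, $B_p$ is a constant matrix, $\Phi$ is a known (matrix-valued) basis function, $x_p(t)$ is the plant state, and $\tilde\theta(t)=\theta(t)-\theta_c$ with $\theta(t)\in\mathbb{R}^n$ the parameter estimate and $\theta_c=\theta_*\in\mathbb{R}^n$ the constant true parameter. For a given $Q_e=Q_e^T>0$, $P_e=P_e^T>0$ is the solution of $A_m^TP_e+P_eA_m=-Q_e$. Objective function: $f(\theta)=\dot V_e+L(\theta)$, where $\dot V_e=-\frac12e^TQ_ee+e^TP_eB_p\Phi(x_p)(\theta-\theta_c)$ is the derivative of $V_e=\frac12e^TP_ee$ along the error dynamics, and $L(\theta)=\frac12(\theta-\theta_c)^T\Omega^2(\theta-\theta_c)$ is a measurable learning loss, with $\Omega=\mathcal{F}[\Phi^T\Phi]$ the symmetric matrix obtained by applying a stable linear filter $\mathcal{F}$ to $\Phi^T\Phi$. The function $f$ is differentiable and convex in $\theta$; $\nabla_\theta f$ is its gradient with respect to $\theta$, and $D_f(p,q)=f(p)-f(q)-\langle\nabla_\theta f(q),p-q\rangle$ is its Bregman divergence. Parameter update law: let $m\ge1$, let $a_0,\dots,a_{m-1}\in\mathbb{R}$ be constants such that $A$ below is Hurwitz, and let $$A=\begin{bmatrix}0&1&0&\cdots&0\\0&0&1&\cdots&0\\\vdots&\vdots&\vdots&\ddots&\vdots\\0&0&0&\cdots&1\\-a_0&-a_1&-a_2&\cdots&-a_{m-1}\end{bmatrix}\otimes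 I_n,\qquad B=\begin{bmatrix}0\\0\\\vdots\\0\\1\end{bmatrix}\otimes I_n$$ (for $m=1$: $A=-a_0I_n$, $B=I_n$). Let $Q=Q^T>0$ be given, $P=P^T>0$ the solution of $A^TP+PA=-Q$, and $C=B^TP$. Let $\alpha(t)\ne0$ and let $\gamma$ be differentiable with $\gamma(t)>0$, $\dot\gamma(t)>0$ for all $t\ge t_0$. Define $U(v,t)=\gamma(t)[f(\gamma(t)^{-1}v+\theta_c)-f(\theta_c)]$, so that $\nabla_vU(v,t)=\nabla_\theta f(\theta)$ with $\theta=\gamma(t)^{-1}v+\theta_c$; it is assumed that $U(v(t),t)\ge0$ for all $t\ge t_0$. The update law is $$\dot x=Ax+Bu,\quad u=-\alpha(t)\nabla_vU(v,t),\quad y=Cx,\quad \dot v+z=\alpha(t)y,\quad z=\tilde\theta=\frac{v}{\gamma(t)},\quad \theta=\gamma(t)^{-1}v+\theta_c.$$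
   Formalization: Added: the derivative of f(θ)−f(θ_c) in time through e, Φ(x_p), Ω, with θ frozen at θ(t), is zero for all t≥t_0 (otherwise the formula in (i) misses a term and the claim is false); and Φ(x_p(t)) is continuous in t. *)

(* Defs.v *)
From HB Require Import structures.
From mathcomp Require Import all_boot all_order all_algebra.
From mathcomp Require Import all_classical all_reals all_analysis.
From mathcomp.real_closed Require Import complex mxtens.

Set Implicit Arguments.
Unset Strict Implicit.
Unset Printing Implicit Defensive.

Import Order.TTheory GRing.Theory Num.Theory.
Import numFieldNormedType.Exports.

Local Open Scope classical_set_scope.
Local Open Scope ring_scope.

Definition dotmx (R : realType) (n : nat) (u v : 'cV[R]_n) : R :=
  (u^T *m v) 0 0.

Definition quadmx (R : realType) (n : nat) (M : 'M[R]_n) (u : 'cV[R]_n) : R :=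
  (u^T *m M *m u) 0 0.

Definition sym_posdef (R : realType) (n : nat) (M : 'M[R]_n) : Prop :=
  M^T = M /\ forall u : 'cV[R]_n, u != 0 -> 0 < quadmx M u.

(* The eigenvalues of a real matrix are taken in R[i]. *)
Definition hurwitz (R : realType) (n : nat) (M : 'M[R]_n) : Prop :=
  forall z : R[i], eigenvalue (map_mx (real_complex R) M) z -> complex.Re z < 0.

(* The derivative relative to the half-line [t0, +oo[: two-sided for t0 < t,
   one-sided at t = t0, where the signals start. *)
Definition is_derive_from (R : realType) (V : normedModType R) (t0 : R)
    (g : R -> V) (t : R) (dg : V) : Prop :=
  h^-1 *: (g (t + h) - g t)
    @[h --> within [set h | t0 <= t + h] (0 : R)^'] --> dg.

Definition continuous_from (R : realType) (V : normedModType R) (t0 : R)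
    (g : R -> V) : Prop :=
  {within [set t | t0 <= t], continuous g}.

Definition grad (R : realType) (n : nat) (g : 'cV[R]_n -> R) (p : 'cV[R]_n) :
    'cV[R]_n :=
  \col_i 'D_(delta_mx i 0) g p.

Definition bregman (R : realType) (n : nat) (g : 'cV[R]_n -> R)
    (p q : 'cV[R]_n) : R :=
  g p - g q - dotmx (grad g q) (p - q).

Definition bounded_from (R : realType) (t0 : R) (w : R -> R) : Prop :=
  exists M, forall t, t0 <= t -> `|w t| <= M.

(* A linear, bounded-input bounded-output stable operator on the continuous
   scalar signals on [t0, +oo[; no finite-dimensional realization is required,
   and neither are causality or time invariance. *)
Definition stable_linear_filter (R : realType) (t0 : R)
    (F : (R -> R) -> R -> R) : Prop :=
  [/\ forall w : R -> R, continuous_from t0 (w : R -> R^o) ->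
        continuous_from t0 (F w : R -> R^o),
      forall (a : R) (w1 w2 : R -> R),
        continuous_from t0 (w1 : R -> R^o) ->
        continuous_from t0 (w2 : R -> R^o) ->
        forall t, t0 <= t ->
          F (fun s => a * w1 s + w2 s) t = a * F w1 t + F w2 t
    & forall w : R -> R, continuous_from t0 (w : R -> R^o) ->
        bounded_from t0 w -> bounded_from t0 (F w)].

Definition filter_mx (R : realType) (n : nat) (F : (R -> R) -> R -> R)
    (W : R -> 'M[R]_n) (t : R) : 'M[R]_n :=
  \matrix_(i, j) F (fun s => W s i j) t.

Definition companion_block (R : realType) (m : nat) (a : 'I_m -> R) : 'M[R]_m :=
  \matrix_(i, j) (if i.+1 == m :> nat then - a j else (j == i.+1 :> nat)%:R).

Definition last_unit (R : realType) (m : nat) : 'cV[R]_m :=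
  \col_i (i.+1 == m :> nat)%:R.

Definition optimiser_A (R : realType) (m n : nat) (a : 'I_m -> R) :
    'M[R]_(m * n) :=
  companion_block a *t (1%:M : 'M[R]_n).

(* The cast only rewrites the number of columns 1 * n as n. *)
Definition optimiser_B (R : realType) (m n : nat) : 'M[R]_(m * n, n) :=
  castmx (erefl _, mul1n n) (last_unit R m *t (1%:M : 'M[R]_n)).

(* \dot V_e as a function of the current error e, the current value of the
   basis function and the parameter th. *)
Definition Ve_rate (R : realType) (d p n : nat) (Qe Pe : 'M[R]_d)
    (Bp : 'M[R]_(d, p)) (thetac : 'cV[R]_n)
    (e : 'cV[R]_d) (Phi : 'M[R]_(p, n)) (th : 'cV[R]_n) : R :=
  - (2^-1 * quadmx Qe e) + (e^T *m Pe *m Bp *m Phi *m (th - thetac)) 0 0.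

Definition learning_loss (R : realType) (n : nat) (thetac : 'cV[R]_n)
    (Omega : 'M[R]_n) (th : 'cV[R]_n) : R :=
  2^-1 * quadmx (Omega *m Omega) (th - thetac).

(* Main.v *)
Require Import Defs.
From HB Require Import structures.
From mathcomp Require Import all_boot all_order all_algebra.
From mathcomp Require Import all_classical all_reals all_analysis.
From mathcomp.real_closed Require Import complex mxtens.
From mathcomp Require Import ring lra.

Set Implicit Arguments.
Unset Strict Implicit.
Unset Printing Implicit Defensive.

Import Order.TTheory GRing.Theory Num.Theory.
Import numFieldNormedType.Exports.

Local Open Scope classical_set_scope.
Local Open Scope ring_scope.

(* With w = theta - thetac, b = (e^T Pe Bp Phi)^T and S = Omega^2, the objective
   is f = f(thetac) + b.w + w^T S w / 2, so U = gamma (b.w + w^T S w / 2) and the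
   gradients of f and of U both equal b + S w. The Lyapunov equations give
   V' = - x^T Q x / 2 - alpha y.grad and Ve' = - e^T Qe e / 2 + b.w, while U'
   contributes - gamma' D_f and grad.(alpha y - w): the alpha terms cancel and
   b.w - grad.w leaves - w^T S w. V_T is then nonincreasing, and
   V, Ve are nonnegative. The explicit time dependence of f is
   only known to vanish at the frozen current estimate; continuity of b and S in
   time makes this sufficient. *)

Section matrix_limits.
Variables (R : realType) (T : Type) (F : set_system T).
Hypothesis FF : Filter F.

Lemma cvg_coordP m n (M : T -> 'M[R]_(m, n)) (L : 'M[R]_(m, n)) :
  M @ F --> L <-> forall i j, M h i j @[h --> F] --> L i j.
Proof.
split=> [ML i j|ML].
  exact: (@cvg_comp _ _ _ M (fun N : 'M[R]_(m, n) => N i j) F (nbhs L)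
    (nbhs (L i j)) ML (@coord_continuous R m n i j L)).
apply/cvg_ballP => eps eps0; rewrite near_simpl.
suff : \forall h \near F, forall i j, ball (L i j) eps (M h i j).
  by apply: filterS => h hM; split.
apply: filter_forall => i; apply: filter_forall => j.
by move/cvg_ballP : (ML i j) => /(_ _ eps0).
Qed.

Lemma cvg_mulmx m n p (M : T -> 'M[R]_(m, n)) (N : T -> 'M[R]_(n, p))
    (M0 : 'M[R]_(m, n)) (N0 : 'M[R]_(n, p)) :
  M @ F --> M0 -> N @ F --> N0 -> M h *m N h @[h --> F] --> M0 *m N0.
Proof.
move=> /cvg_coordP MM0 /cvg_coordP NN0; apply/cvg_coordP => i j; rewrite mxE.
under eq_fun do rewrite mxE.
apply: cvg_big => [|k _]; first exact: add_continuous.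
exact: cvgM.
Qed.

Lemma cvg_trmx m n (M : T -> 'M[R]_(m, n)) (M0 : 'M[R]_(m, n)) :
  M @ F --> M0 -> (M h)^T @[h --> F] --> M0^T.
Proof.
move=> /cvg_coordP MM0; apply/cvg_coordP => i j; rewrite mxE.
by under eq_fun do rewrite mxE; exact: MM0.
Qed.

End matrix_limits.

Section derivative_from.
Variables (R : realType) (t0 : R).
Local Notation steps t := (within [set h | t0 <= t + h] (0 : R)^').

Lemma steps_neq0 (t : R) : \forall h \near steps t, h != 0.
Proof.
rewrite near_withinE; near=> h => _; near: h; exact: nbhs_dnbhs_neq.
Unshelve. all: by end_near. Qed.

Lemma steps_ge (t : R) : \forall h \near steps t, t0 <= t + h.
Proof. by rewrite near_withinE; exact: filterE. Qed.

Lemma is_derive_from_near (V : normedModType R) (g1 g2 : R -> V) t dg :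
  t0 <= t -> (forall s, t0 <= s -> g1 s = g2 s) ->
  is_derive_from t0 g1 t dg -> is_derive_from t0 g2 t dg.
Proof.
move=> tt0 g12; apply: cvg_trans; apply: near_eq_cvg.
by near=> h; rewrite !g12//; near: h; exact: steps_ge.
Unshelve. all: by end_near. Qed.

Lemma is_derive_from_cvg (V : normedModType R) (g : R -> V) t dg :
  is_derive_from t0 g t dg -> g (t + h) @[h --> steps t] --> g t.
Proof.
move=> Dg.
have: h *: (h^-1 *: (g (t + h) - g t)) + g t @[h --> steps t] --> 0 *: dg + g t.
  apply: cvgD; last exact: cvg_cst.
  apply: cvgZ => //.
  do 2! apply: cvg_within_filter; exact: cvg_id.
rewrite scale0r add0r; apply: cvg_trans; apply: near_eq_cvg.
near=> h; rewrite scalerA mulfV ?scale1r ?subrK//.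
by near: h; exact: steps_neq0.
Unshelve. all: by end_near. Qed.

Lemma continuous_from_cvg (V : normedModType R) (g : R -> V) t :
  t0 <= t -> continuous_from t0 g -> g (t + h) @[h --> steps t] --> g t.
Proof.
move=> tt0 /subspace_continuousP /(_ t tt0) cg U Ug.
have: \forall s \near t, t0 <= s -> U (g s) := cg U Ug.
move/nbhs0P => gU; have: \forall h \near (0 : R)^', t0 <= t + h -> U (g (t + h)).
  exact: cvg_within.
by [].
Qed.

Lemma cvg_continuous_from (V : normedModType R) (g : R -> V) :
  (forall t, t0 <= t -> g (t + h) @[h --> steps t] --> g t) ->
  continuous_from t0 g.
Proof.
move=> cg; apply/subspace_continuousP => t tt0 U gU.
have: \forall h \near (0 : R)^', t0 <= t + h -> U (g (t + h)) := cg t tt0 U gU.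
rewrite near_withinE => hU.
suff: \forall s \near t, t0 <= s -> U (g s) by [].
apply/nbhs0P; move: hU; apply: filterS => h hU th.
have [->|h0] := eqVneq h 0; last exact: hU.
by rewrite addr0; exact: nbhs_singleton.
Qed.

Lemma is_derive_fromD (V : normedModType R) (g1 g2 : R -> V) t dg1 dg2 :
  is_derive_from t0 g1 t dg1 -> is_derive_from t0 g2 t dg2 ->
  is_derive_from t0 (fun s => g1 s + g2 s) t (dg1 + dg2).
Proof.
move=> D1 D2; rewrite /is_derive_from.
under eq_fun do rewrite opprD addrACA scalerDr.
exact: cvgD.
Qed.

Lemma is_derive_fromZ (V : normedModType R) (c : R -> R^o) (g : R -> V) t dc dg :
  is_derive_from t0 c t dc -> is_derive_from t0 g t dg ->
  is_derive_from t0 (fun s => c s *: g s) t (dc *: g t + c t *: dg).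
Proof.
move=> Dc Dg; rewrite /is_derive_from.
have -> : (fun h => h^-1 *: (c (t + h) *: g (t + h) - c t *: g t)) =
  (fun h => (h^-1 *: (c (t + h) - c t)) *: g (t + h)
            + c t *: (h^-1 *: (g (t + h) - g t))).
  apply/funext => h; rewrite [h^-1 *: (c _ - c _)]/(h^-1 * (c (t + h) - c t)).
  rewrite -scalerA [c t *: (_ *: _)]scalerA [c t * _]mulrC -scalerA -scalerDr.
  by congr (_ *: _); rewrite scalerBl scalerBr subrKA.
apply: cvgD; first by apply: cvgZ => //; exact: is_derive_from_cvg Dg.
by apply: cvgZ => //; exact: cvg_cst.
Qed.

Lemma is_derive_fromV (c : R -> R^o) t dc :
  t0 <= t -> (forall s, t0 <= s -> c s != 0) -> is_derive_from t0 c t dc ->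
  is_derive_from t0 (fun s => (c s)^-1 : R^o) t (- ((c t)^-1 * (c t)^-1 * dc)).
Proof.
move=> tt0 c0 Dc; have c_cvg := is_derive_from_cvg Dc.
have: - ((c (t + h))^-1 * (c t)^-1 * (h^-1 *: (c (t + h) - c t)))
    @[h --> steps t] --> - ((c t)^-1 * (c t)^-1 * dc).
  apply: cvgN; apply: cvgM => //; apply: cvgM; last exact: cvg_cst.
  by apply: cvgV => //; exact: c0.
apply: cvg_trans; apply: near_eq_cvg; near=> h.
have ch0 : c (t + h) != 0 by apply: c0; near: h; exact: steps_ge.
have h0 : h != 0 by near: h; exact: steps_neq0.
have ct0 := c0 t tt0.
rewrite /GRing.scale/=; field.
by apply/and3P; split.
Unshelve. all: by end_near. Qed.

Lemma is_derive_from_mulmx m n p (M : R -> 'M[R]_(m, n)) (N : R -> 'M[R]_(n, p))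
    t (dM : 'M[R]_(m, n)) (dN : 'M[R]_(n, p)) :
  is_derive_from t0 M t dM -> is_derive_from t0 N t dN ->
  is_derive_from t0 (fun s => M s *m N s) t (dM *m N t + M t *m dN).
Proof.
move=> DM DN; rewrite /is_derive_from.
have -> : (fun h => h^-1 *: (M (t + h) *m N (t + h) - M t *m N t)) =
  (fun h => (h^-1 *: (M (t + h) - M t)) *m N (t + h)
            + M t *m (h^-1 *: (N (t + h) - N t))).
  apply/funext => h; rewrite -scalemxAl -scalemxAr -scalerDr.
  by rewrite mulmxBl mulmxBr subrKA.
apply: cvgD; apply: cvg_mulmx => //; first exact: is_derive_from_cvg DN.
exact: cvg_cst.
Qed.

Lemma is_derive_from_trmx m n (M : R -> 'M[R]_(m, n)) t (dM : 'M[R]_(m, n)) :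
  is_derive_from t0 M t dM -> is_derive_from t0 (fun s => (M s)^T) t dM^T.
Proof.
rewrite /is_derive_from => /cvg_trmx.
by under eq_fun do rewrite linearZ/= linearB/=.
Qed.

Lemma is_derive_from_coord m n i j (M : R -> 'M[R]_(m, n)) t (dM : 'M[R]_(m, n)) :
  is_derive_from t0 M t dM -> is_derive_from t0 (fun s => M s i j : R^o) t (dM i j).
Proof.
rewrite /is_derive_from => /cvg_coordP /(_ i j).
by under eq_fun do rewrite !mxE.
Qed.

Lemma is_derive_from_cst (V : normedModType R) (c : V) t :
  is_derive_from t0 (fun=> c) t 0.
Proof.
rewrite /is_derive_from; under eq_fun do rewrite subrr scaler0.
exact: cvg_cst.
Qed.

Lemma is_derive_from_le (g dg : R -> R) t :
  (forall s, t0 <= s -> is_derive_from t0 (g : R -> R^o) s (dg s)) ->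
  (forall s, t0 <= s -> dg s <= 0) -> t0 <= t -> g t <= g t0.
Proof.
move=> Dg dg0 tt0.
have Dg1 s : t0 < s -> is_derive s 1 (g : R -> R^o) (dg s).
  move=> ts.
  have Dgs : h^-1 *: ((g (h *: 1 + s) : R^o) - g s) @[h --> 0^'] --> (dg s : R^o).
    move=> U /(Dg _ (ltW ts)) hU.
    have {}hU : \forall h \near 0^', t0 <= s + h -> U (h^-1 *: (g (s + h) - g s)).
      exact: hU.
    have sh : \forall h \near (0 : R)^', t0 < s + h.
      apply: cvg_within; have /nbhs0P : \forall r \near s, t0 < r by exact: lt_nbhsr.
      by [].
    suff: \forall h \near 0^', U (h^-1 *: ((g (h *: 1 + s) : R^o) - g s)) by [].
    near=> h; rewrite [h *: 1]mulr1 [h + s]addrC.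
    have /ltW : t0 < s + h by near: h.
    by near: h.
  by apply: DeriveDef; [apply/cvg_ex; exists (dg s)|exact: cvg_lim].
apply: (@ler0_derive1_nincry _ g t0) => //.
- by move=> s; rewrite in_itv/= andbT => /Dg1[].
- move=> s; rewrite in_itv/= andbT => ts; have := Dg1 _ ts => ?.
  by rewrite derive1E derive_val dg0// ltW.
- have -> : [set` `[t0, +oo[] = [set s | t0 <= s].
    by apply/funext => s; rewrite /= in_itv/= andbT.
  apply: cvg_continuous_from => s ts; exact: is_derive_from_cvg (Dg s ts).
Unshelve. all: by end_near. Qed.

End derivative_from.

(* The libraries have another [dotmx], for Hermitian forms. *)
Local Notation dotmx := Defs.dotmx.

Section quadratic_forms.
Variable R : realType.

Lemma dotmxC n (u v : 'cV[R]_n) : dotmx u v = dotmx v u.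
Proof.
rewrite /dotmx; have -> : v^T *m u = (u^T *m v)^T by rewrite trmx_mul trmxK.
by rewrite [RHS]mxE.
Qed.

Lemma dotmxDr n (u v w : 'cV[R]_n) : dotmx u (v + w) = dotmx u v + dotmx u w.
Proof. by rewrite /dotmx mulmxDr mxE. Qed.

Lemma dotmxDl n (u v w : 'cV[R]_n) : dotmx (u + v) w = dotmx u w + dotmx v w.
Proof. by rewrite dotmxC dotmxDr !(dotmxC w). Qed.

Lemma dotmxZr n c (u v : 'cV[R]_n) : dotmx u (c *: v) = c * dotmx u v.
Proof. by rewrite /dotmx -scalemxAr mxE. Qed.

Lemma dotmxZl n c (u v : 'cV[R]_n) : dotmx (c *: u) v = c * dotmx u v.
Proof. by rewrite dotmxC dotmxZr dotmxC. Qed.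

Lemma dotmxNr n (u v : 'cV[R]_n) : dotmx u (- v) = - dotmx u v.
Proof. by rewrite -scaleN1r dotmxZr mulN1r. Qed.

Lemma dotmx_mulmx m n (M : 'M[R]_(m, n)) (u : 'cV[R]_m) (v : 'cV[R]_n) :
  dotmx u (M *m v) = dotmx (M^T *m u) v.
Proof. by rewrite /dotmx trmx_mul trmxK mulmxA. Qed.

Lemma dotmx_ge0 n (u : 'cV[R]_n) : 0 <= dotmx u u.
Proof. by rewrite /dotmx mxE sumr_ge0// => i _; rewrite mxE -expr2 sqr_ge0. Qed.

Lemma dotmx_delta n (u : 'cV[R]_n) i : dotmx u (delta_mx i 0) = u i 0.
Proof.
rewrite /dotmx -colE.
by rewrite !mxE.
Qed.

Lemma quadmxE n (M : 'M[R]_n) u : quadmx M u = dotmx u (M *m u).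
Proof. by rewrite /quadmx /dotmx mulmxA. Qed.

Lemma quadmx_ge0 n (M : 'M[R]_n) u : sym_posdef M -> 0 <= quadmx M u.
Proof.
case=> _ M_gt0; have [->|/M_gt0/ltW//] := eqVneq u 0.
by rewrite /quadmx mulmx0 mxE.
Qed.

Lemma quadmxB n (M : 'M[R]_n) u v : M^T = M ->
  quadmx M u - quadmx M v = dotmx (M *m (u + v)) (u - v).
Proof.
move=> Msym; rewrite !quadmxE mulmxDr dotmxDl !dotmxDr !dotmxNr.
rewrite (dotmx_mulmx M u u) (dotmx_mulmx M v v) !Msym.
by rewrite -(dotmxC v (M *m u)) (dotmx_mulmx M v u) Msym; ring.
Qed.

Lemma quadmx_sqr n (M : 'M[R]_n) u :
  M^T = M -> quadmx (M *m M) u = dotmx (M *m u) (M *m u).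
Proof. by move=> Msym; rewrite quadmxE -mulmxA dotmx_mulmx Msym. Qed.

Lemma lyapunov_quadmx n (A P Q : 'M[R]_n) u : P^T = P ->
  A^T *m P + P *m A = - Q -> dotmx (P *m u) (A *m u) = - (2^-1 * quadmx Q u).
Proof.
move=> Psym AP; have -> : Q = - (A^T *m P + P *m A) by rewrite AP opprK.
rewrite quadmxE mulNmx dotmxNr mulmxDl dotmxDr -!mulmxA.
rewrite (dotmx_mulmx A^T) trmxK (dotmx_mulmx P u) Psym (dotmxC (A *m u)).
by field.
Qed.

Lemma is_derive_from_dotmx t0 n (u v : R -> 'cV[R]_n) t (du dv : 'cV[R]_n) :
  is_derive_from t0 u t du -> is_derive_from t0 v t dv ->
  is_derive_from t0 (fun s => dotmx (u s) (v s) : R^o) t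
    (dotmx du (v t) + dotmx (u t) dv).
Proof.
move=> Du Dv.
have := is_derive_from_mulmx (is_derive_from_trmx Du) Dv.
by move=> /(is_derive_from_coord (i := 0) (j := 0)); rewrite mxE.
Qed.

Lemma is_derive_from_quadmx t0 n (M : 'M[R]_n) (u : R -> 'cV[R]_n) t (du : 'cV[R]_n) :
  M^T = M -> is_derive_from t0 u t du ->
  is_derive_from t0 (fun s => 2^-1 * quadmx M (u s) : R^o) t
    (dotmx (M *m u t) du).
Proof.
move=> Msym Du.
have DMu : is_derive_from t0 (fun s => M *m u s) t (M *m du).
  have := is_derive_from_mulmx (is_derive_from_cst t0 M t) Du.
  by rewrite mul0mx add0r.
have := is_derive_fromZ (is_derive_from_cst t0 (2^-1 : R^o) t)
  (is_derive_from_dotmx Du DMu).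
rewrite scale0r add0r (dotmx_mulmx M (u t)) Msym (dotmxC du).
under eq_fun do rewrite -quadmxE.
by congr is_derive_from; rewrite /GRing.scale/=; field.
Qed.

(* The increments split as [q s (w s) - q s (w t)] plus [q s (w t) - q t (w t)];
   only continuity of the coefficients is needed for the first. *)
Lemma is_derive_from_quadratic t0 n (b : R -> 'cV[R]_n) (S : R -> 'M[R]_n)
    (w : R -> 'cV[R]_n) t (dw : 'cV[R]_n) (dq : R) :
  t0 <= t -> continuous_from t0 b -> continuous_from t0 S ->
  (forall s, (S s)^T = S s) ->
  is_derive_from t0 w t dw ->
  is_derive_from t0
    (fun s => dotmx (b s) (w t) + 2^-1 * quadmx (S s) (w t) : R^o) t dq ->
  is_derive_from t0
    (fun s => dotmx (b s) (w s) + 2^-1 * quadmx (S s) (w s) : R^o) t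
    (dotmx (b t + S t *m w t) dw + dq).
Proof.
move=> tt0 b_cont S_cont S_sym Dw Dq; rewrite /is_derive_from.
pose r h : 'cV[R]_n := b (t + h) + 2^-1 *: (S (t + h) *m (w (t + h) + w t)).
have -> : (fun h => h^-1 *: (dotmx (b (t + h)) (w (t + h))
      + 2^-1 * quadmx (S (t + h)) (w (t + h))
      - (dotmx (b t) (w t) + 2^-1 * quadmx (S t) (w t)) : R^o)) =
  (fun h => dotmx (r h) (h^-1 *: (w (t + h) - w t))
    + h^-1 *: (dotmx (b (t + h)) (w t) + 2^-1 * quadmx (S (t + h)) (w t)
               - (dotmx (b t) (w t) + 2^-1 * quadmx (S t) (w t)) : R^o)).
  apply/funext => h; rewrite dotmxZr /GRing.scale/= -mulrDr; congr (_ * _).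
  rewrite /r dotmxDl dotmxZl -quadmxB // dotmxDr dotmxNr.
  by ring.
apply: cvgD => //.
have b_cvg := continuous_from_cvg tt0 b_cont.
have S_cvg := continuous_from_cvg tt0 S_cont.
have w_cvg := is_derive_from_cvg Dw.
have r_cvg : r h @[h --> within [set h | t0 <= t + h] (0 : R)^'] --> b t + S t *m w t.
  have -> : S t *m w t = 2^-1 *: (S t *m (w t + w t)).
    rewrite mulmxDr scalerDr -scalerDl.
    have -> : 2^-1 + 2^-1 = 1 :> R by field.
    by rewrite scale1r.
  apply: cvgD => //; apply: cvgZ; first exact: cvg_cst.
  by apply: cvg_mulmx => //; apply: cvgD => //; exact: cvg_cst.
rewrite /dotmx; apply: (cvg_coordP _ _ _).1.
by apply: cvg_mulmx => //; exact: cvg_trmx.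
Qed.

Lemma grad_quadratic n c (b o : 'cV[R]_n) (S : 'M[R]_n) (g : 'cV[R]_n -> R) p :
  S^T = S ->
  (forall q, g q = c + dotmx b (q - o) + 2^-1 * quadmx S (q - o)) ->
  grad g p = b + S *m (p - o).
Proof.
move=> Ssym gE; apply/matrixP => i j; rewrite [j]ord1 {j} mxE -[RHS]dotmx_delta.
set d := delta_mx i 0; apply: cvg_lim => //.
have : dotmx (b + S *m (p - o)) d + h * (2^-1 * quadmx S d)
  @[h --> (0 : R)^'] --> dotmx (b + S *m (p - o)) d + 0 * (2^-1 * quadmx S d).
  apply: cvgD; first exact: cvg_cst.
  apply: cvgM; last exact: cvg_cst.
  by apply: cvg_within_filter; exact: cvg_id.
rewrite mul0r addr0; apply: cvg_trans; apply: near_eq_cvg.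
near=> h; have h0 : h != 0 by near: h; exact: nbhs_dnbhs_neq.
rewrite /= !gE; have -> : h *: d + p - o = h *: d + (p - o) by rewrite addrA.
move: (p - o) => {}p.
rewrite !quadmxE mulmxDr !dotmxDr !dotmxDl -scalemxAr !(dotmxZr, dotmxZl).
have -> : dotmx p (S *m d) = dotmx (S *m p) d by rewrite dotmx_mulmx Ssym.
rewrite (dotmxC d (S *m p)) /GRing.scale/=.
by field.
Unshelve. all: by end_near. Qed.

End quadratic_forms.

Lemma continuous_from_coordP (R : realType) (t0 : R) m n (M : R -> 'M[R]_(m, n)) :
  continuous_from t0 M <->
  forall i j, continuous_from t0 (fun t => M t i j : R^o).
Proof.
split=> [Mc i j|Mc]; apply: cvg_continuous_from => t tt0.
  by move/cvg_coordP : (continuous_from_cvg tt0 Mc); exact.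
by apply/cvg_coordP => i j; exact: continuous_from_cvg tt0 (Mc i j).
Qed.

Lemma continuous_from_mulmx (R : realType) (t0 : R) m n p
    (M : R -> 'M[R]_(m, n)) (N : R -> 'M[R]_(n, p)) :
  continuous_from t0 M -> continuous_from t0 N ->
  continuous_from t0 (fun t => M t *m N t).
Proof.
move=> Mc Nc; apply: cvg_continuous_from => t tt0.
by apply: cvg_mulmx; exact: continuous_from_cvg.
Qed.

Lemma continuous_from_trmx (R : realType) (t0 : R) m n (M : R -> 'M[R]_(m, n)) :
  continuous_from t0 M -> continuous_from t0 (fun t => (M t)^T).
Proof.
move=> Mc; apply: cvg_continuous_from => t tt0.
by apply: cvg_trmx; exact: continuous_from_cvg.
Qed.

Lemma continuous_from_cst (R : realType) (t0 : R) (V : normedModType R) (c : V) :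
  continuous_from t0 (fun=> c).
Proof. by apply: cvg_continuous_from => t _; exact: cvg_cst. Qed.

Lemma continuous_from_filter_mx (R : realType) (t0 : R) n F (W : R -> 'M[R]_n) :
  stable_linear_filter t0 F -> continuous_from t0 W ->
  continuous_from t0 (filter_mx F W).
Proof.
case=> Fc _ _ /continuous_from_coordP Wc; apply/continuous_from_coordP => i j.
by rewrite /filter_mx; under eq_fun do rewrite mxE; exact/Fc/Wc.
Qed.

Lemma filter_mx_sym (R : realType) n (F : (R -> R) -> R -> R) (W : R -> 'M[R]_n) t :
  (forall s, (W s)^T = W s) -> (filter_mx F W t)^T = filter_mx F W t.
Proof.
move=> Wsym; apply/matrixP => i j; rewrite !mxE; congr (F _ t).
by apply/funext => s; rewrite -[in LHS]Wsym mxE.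
Qed.

Theorem mainTheorem2 (R : realType) (t0 : R)
    (* tracking error dynamics *)
    (d p n k : nat)
    (Am : 'M[R]_d) (Bp : 'M[R]_(d, p)) (Phi : 'cV[R]_k -> 'M[R]_(p, n))
    (Qe Pe : 'M[R]_d) (thetac : 'cV[R]_n)
    (xp : R -> 'cV[R]_k) (e : R -> 'cV[R]_d) (theta : R -> 'cV[R]_n)
    (Am_hurwitz : hurwitz Am)
    (Qe_spd : sym_posdef Qe) (Pe_spd : sym_posdef Pe)
    (Pe_lyapunov : Am^T *m Pe + Pe *m Am = - Qe)
    (Phi_cont : continuous_from t0 (fun t => Phi (xp t)))
    (e_dyn : forall t, t0 <= t ->
       is_derive_from t0 e t
         (Am *m e t + Bp *m Phi (xp t) *m (theta t - thetac)))
    (* objective function *)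
    (F : (R -> R) -> R -> R) (Omega : R -> 'M[R]_n)
    (f : R -> 'cV[R]_n -> R)
    (F_filter : stable_linear_filter t0 F)
    (Omega_def : forall t,
       Omega t = filter_mx F (fun s => (Phi (xp s))^T *m Phi (xp s)) t)
    (f_def : forall t th,
       f t th = Ve_rate Qe Pe Bp thetac (e t) (Phi (xp t)) th
                + learning_loss thetac (Omega t) th)
    (* f and U = gamma (f - f thetac) are differentiated as functions of theta
       only: the explicit time derivative of the gap f - f thetac, due to e,
       Phi (xp t) and Omega, vanishes at the current estimate *)
    (f_autonomous : forall t, t0 <= t ->
       is_derive_from t0 (fun s => f s (theta t) - f s thetac : R^o) t 0)
    (* parameter update law *)
    (m : nat) (m_gt0 : (0 < m)%N) (a : 'I_m -> R)
    (A : 'M[R]_(m * n)) (B : 'M[R]_(m * n, n)) (C : 'M[R]_(n, m * n))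
    (Q P : 'M[R]_(m * n))
    (A_def : A = optimiser_A n a) (B_def : B = optimiser_B R m n)
    (A_hurwitz : hurwitz A)
    (Q_spd : sym_posdef Q) (P_spd : sym_posdef P)
    (P_lyapunov : A^T *m P + P *m A = - Q)
    (C_def : C = B^T *m P)
    (alpha gamma dgamma : R -> R)
    (alpha_neq0 : forall t, t0 <= t -> alpha t != 0)
    (gamma_derive : forall t, t0 <= t ->
       is_derive_from t0 (gamma : R -> R^o) t (dgamma t))
    (gamma_gt0 : forall t, t0 <= t -> 0 < gamma t)
    (dgamma_gt0 : forall t, t0 <= t -> 0 < dgamma t)
    (U : 'cV[R]_n -> R -> R)
    (U_def : forall w t,
       U w t = gamma t * (f t ((gamma t)^-1 *: w + thetac) - f t thetac))
    (x : R -> 'cV[R]_(m * n)) (u y v dv z : R -> 'cV[R]_n)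
    (x_dyn : forall t, t0 <= t -> is_derive_from t0 x t (A *m x t + B *m u t))
    (u_def : forall t, t0 <= t -> u t = - alpha t *: grad (U^~ t) (v t))
    (y_def : forall t, t0 <= t -> y t = C *m x t)
    (v_derive : forall t, t0 <= t -> is_derive_from t0 v t (dv t))
    (v_dyn : forall t, t0 <= t -> dv t + z t = alpha t *: y t)
    (z_def : forall t, t0 <= t -> z t = (gamma t)^-1 *: v t)
    (theta_def : forall t, t0 <= t ->
       theta t = (gamma t)^-1 *: v t + thetac)
    (U_ge0 : forall t, t0 <= t -> 0 <= U (v t) t)
    (* storage functions *)
    (V Ve VT : R -> R) (EAC : R)
    (V_def : forall t, V t = 2^-1 * quadmx P (x t))
    (Ve_def : forall t, Ve t = 2^-1 * quadmx Pe (e t))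
    (VT_def : forall t, VT t = V t + U (v t) t + Ve t)
    (EAC_def : EAC = V t0 + U (v t0) t0 + Ve t0) :
  forall t, t0 <= t ->
    (let VT_rate :=
       - (2^-1 * quadmx Q (x t)) - 2^-1 * quadmx Qe (e t)
       - dgamma t * bregman (f t) thetac (theta t)
       - quadmx (Omega t *m Omega t) (theta t - thetac) in
     is_derive_from t0 (VT : R -> R^o) t VT_rate /\ VT_rate <= 0) /\
    [/\ V t + U (v t) t + Ve t <= EAC,
        U (v t) t <= V t + U (v t) t + Ve t,
        U (v t) t = gamma t * (f t (theta t) - f t thetac)
      & f t (theta t) - f t thetac <= EAC / gamma t].
Proof.
pose S t := Omega t *m Omega t.
have Omega_sym t : (Omega t)^T = Omega t.
  rewrite Omega_def; apply: filter_mx_sym => s.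
  by rewrite trmx_mul trmxK.
have S_sym t : (S t)^T = S t by rewrite trmx_mul Omega_sym.
have S_cont : continuous_from t0 S.
  suff Oc : continuous_from t0 Omega by exact: continuous_from_mulmx.
  have -> : Omega = filter_mx F (fun s => (Phi (xp s))^T *m Phi (xp s)).
    by apply/funext => t; exact: Omega_def.
  apply: continuous_from_filter_mx => //.
  by apply: continuous_from_mulmx => //; exact: continuous_from_trmx.
have e_cont : continuous_from t0 e.
  by apply: cvg_continuous_from => t tt0; exact: is_derive_from_cvg (e_dyn t tt0).
pose b t := ((e t)^T *m Pe *m Bp *m Phi (xp t))^T.
have b_cont : continuous_from t0 b.
  apply: continuous_from_trmx; apply: continuous_from_mulmx => //.
  apply: continuous_from_mulmx; last exact: continuous_from_cst.
  apply: continuous_from_mulmx; last exact: continuous_from_cst.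
  exact: continuous_from_trmx.
pose c t := - (2^-1 * quadmx Qe (e t)).
pose q t w := dotmx (b t) w + 2^-1 * quadmx (S t) w.
have fE t th : f t th = c t + q t (th - thetac).
  by rewrite f_def /Ve_rate /learning_loss /q /dotmx trmxK addrA.
have q0 t : q t 0 = 0.
  by rewrite /q /dotmx /quadmx !mulmx0 !mxE mulr0 addr0.
have gapE t th : f t th - f t thetac = q t (th - thetac).
  by rewrite !fE subrr q0 addr0 addrC addKr.
have UE w t : U w t = gamma t * q t ((gamma t)^-1 *: w).
  by rewrite U_def gapE addrK.
pose w t := (gamma t)^-1 *: v t.
have wE t : t0 <= t -> theta t - thetac = w t.
  by move=> tt0; rewrite theta_def // addrK.
pose g t := b t + S t *m w t.
have gradf t : t0 <= t -> grad (f t) (theta t) = g t.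
  move=> tt0; rewrite /g -wE//; apply: grad_quadratic (S_sym t) _ => th.
  by rewrite fE addrA.
have gradU t : t0 <= t -> grad (U^~ t) (v t) = g t.
  move=> tt0; have gt0 := lt0r_neq0 (gamma_gt0 t tt0).
  rewrite (@grad_quadratic _ _ 0 (b t) 0 ((gamma t)^-1 *: S t)) ?linearZ/= ?S_sym//.
    by rewrite subr0 /g /w -scalemxAl -scalemxAr.
  move=> th; rewrite UE subr0 /q !quadmxE -!scalemxAl -!scalemxAr.
  by rewrite !(dotmxZr, dotmxZl); field.
pose rate t := - (2^-1 * quadmx Q (x t)) - 2^-1 * quadmx Qe (e t)
       - dgamma t * bregman (f t) thetac (theta t)
       - quadmx (Omega t *m Omega t) (theta t - thetac).
have bregE t : t0 <= t -> bregman (f t) thetac (theta t) = 2^-1 * quadmx (S t) (w t).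
  move=> tt0; rewrite /bregman gradf// -(opprB (f t (theta t))) gapE -(opprB (theta t)) wE//.
  rewrite dotmxNr /g dotmxDl /q (dotmxC (S t *m _)) -quadmxE.
  by field.
have S_ge0 t z0 : 0 <= quadmx (S t) z0.
  by rewrite quadmx_sqr// dotmx_ge0.
have rate_le0 t : t0 <= t -> rate t <= 0.
  move=> tt0; rewrite /rate bregE// wE// -/(S t).
  have Q0 := quadmx_ge0 (x t) Q_spd.
  have Qe0 := quadmx_ge0 (e t) Qe_spd.
  have D0 : 0 <= dgamma t * (2^-1 * quadmx (S t) (w t)).
    by apply: mulr_ge0; [exact/ltW/dgamma_gt0|rewrite mulr_ge0].
  by have := S_ge0 t (w t); lra.
have Dw t : t0 <= t ->
    is_derive_from t0 w t ((gamma t)^-1 *: (dv t - dgamma t *: w t)).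
  move=> tt0; have gt0 s (ts : t0 <= s) := lt0r_neq0 (gamma_gt0 s ts).
  have := is_derive_fromZ (is_derive_fromV tt0 gt0 (gamma_derive t tt0))
    (v_derive t tt0).
  congr is_derive_from; rewrite /w scalerBr addrC !scalerA -scaleNr.
  by congr (_ + _ *: _); have := gt0 t tt0 => ?; field.
have VT_derive t : t0 <= t -> is_derive_from t0 (VT : R -> R^o) t (rate t).
  move=> tt0.
  have DV := is_derive_from_quadmx P_spd.1 (x_dyn t tt0).
  have DVe := is_derive_from_quadmx Pe_spd.1 (e_dyn t tt0).
  have Dq : is_derive_from t0 (fun s => q s (w t) : R^o) t 0.
    apply: (is_derive_from_near tt0 _ (f_autonomous t tt0)) => s _.
    by rewrite gapE wE.
  have Dqw := is_derive_from_quadratic tt0 b_cont S_cont S_sym (Dw t tt0) Dq.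
  have DU := is_derive_fromZ (gamma_derive t tt0) Dqw.
  have := is_derive_fromD (is_derive_fromD DV DU) DVe.
  have -> : (fun s => 2^-1 * quadmx P (x s)
      + gamma s *: (dotmx (b s) (w s) + 2^-1 * quadmx (S s) (w s) : R^o)
      + 2^-1 * quadmx Pe (e s)) = VT.
    by apply/funext => s; rewrite VT_def V_def Ve_def UE.
  congr is_derive_from.
  rewrite /rate bregE// wE// -/(S t) -/(g t).
  have scaleE (r s : R) : r *: (s : R^o) = r * s by [].
  rewrite !scaleE.
  rewrite !dotmxDr (lyapunov_quadmx _ P_spd.1 P_lyapunov).
  rewrite (lyapunov_quadmx _ Pe_spd.1 Pe_lyapunov).
  have -> : dotmx (P *m x t) (B *m u t) = - alpha t * dotmx (y t) (g t).
    by rewrite dotmx_mulmx mulmxA -C_def -y_def// u_def// dotmxZr gradU.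
  have -> : dotmx (Pe *m e t) (Bp *m Phi (xp t) *m w t) = dotmx (b t) (w t).
    by rewrite /dotmx /b trmxK trmx_mul Pe_spd.1 !mulmxA.
  have -> : dv t = alpha t *: y t - w t.
    by rewrite -v_dyn// z_def// addrK.
  have : dotmx (g t) (w t) = dotmx (b t) (w t) + quadmx (S t) (w t).
    by rewrite dotmxDl (dotmxC (S t *m _)) -quadmxE.
  move: (g t) (w t) (lt0r_neq0 (gamma_gt0 t tt0)) => gt wt gamma_neq0 gw.
  by rewrite !(dotmxZr, dotmxDr, dotmxNr) gw (dotmxC (y t)); field.
move=> t tt0; split; first by split; [exact: VT_derive|exact: rate_le0].
have V_ge0 s : 0 <= V s by rewrite V_def mulr_ge0// quadmx_ge0.
have Ve_ge0 s : 0 <= Ve s by rewrite Ve_def mulr_ge0// quadmx_ge0.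
have VT_le : V t + U (v t) t + Ve t <= EAC.
  by rewrite EAC_def -!VT_def; exact: is_derive_from_le VT_derive rate_le0 tt0.
have U_le : U (v t) t <= V t + U (v t) t + Ve t.
  by have := V_ge0 t; have := Ve_ge0 t; lra.
have U_gap : U (v t) t = gamma t * (f t (theta t) - f t thetac).
  by rewrite U_def theta_def.
split => //; rewrite ler_pdivlMr ?gamma_gt0// mulrC -U_gap.
exact: le_trans U_le VT_le.
Qed.
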